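(* Let $p$ be a prime and let $2\leq q\leq p$. Suppose that $X$ is a paracompact free $\mathbb{Z}_p$-space and $\mathrm{ind}_q(X,\mathbb{Z}_p)<\infty$. (1) Suppose that $\mathrm{secat}(X\to X/\mathbb{Z}_p)=2$. Then: $\mathrm{ind}_q(X,\mathbb{Z}_p)=0$ whenever $q\geq 3$; and $\mathrm{ind}_2(X,\mathbb{Z}_p)=1$ (the case $q=2$). (2) Suppose that $\mathrm{secat}(X\to X/\mathbb{Z}_p)=3$. Then: $\mathrm{ind}_q(X,\mathbb{Z}_p)=0$ whenever $q\geq 4$; $\mathrm{ind}_3(X,\mathbb{Z}_p)=1$ (the case $q=3$); and $\mathrm{ind}_2(X,\mathbb{Z}_p)\in\{1,2\}$ (the case $q=2$).
   Context: ''Space'' means topological space and ''map'' means continuous map. For a finite group $G$, a free $G$-space is a Hausdorff space $X$ on which $G$ acts freely on the left; $X\to X/G$ denotes the quotient map (a fibration). $\mathbb{Z}_p$ is the cyclic group of order $p$. For a finite group $G$ of order $\ell$, $2\leq q\leq\ell$, and a space $Y$, the configuration-like space $F(Y,\ell,q)\subset Y^\ell$ (subspace topology) is the set of all $(y_1,\ldots,y_\ell)\in Y^\ell$ such that for any indices $0<i_1<\cdots<i_q\leq\ell$ at least two of $y_{i_1},\ldots,y_{i_q}$ are different. Fix an enumeration $G=\{g_1,\ldots,g_\ell\}$ and let $h:G\to\{1,\ldots,\ell\}$ be the bijection $h(g_j)=j$. The group $G$ acts on the left on $Y^\ell$ by $g(y_1,\ldots,y_\ell)=(y_{h(g^{-1}g_1)},\ldots,y_{h(g^{-1}g_\ell)})$,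 and this restricts to a left action on $F(Y,\ell,q)$. The $q$-th index $\mathrm{ind}_q(X,G)$ of a free $G$-space $X$ is the least integer $k\in\{0,1,2,\ldots\}$ such that there exists a $G$-equivariant map $X\to F(\mathbb{R}^{k+1},\ell,q)$, and $\mathrm{ind}_q(X,G)=\infty$ if no such $k$ exists. For a fibration $\pi:E\to B$, the sectional category $\mathrm{secat}(\pi)$ is the minimal cardinality of an open cover of $B$ such that each element $U$ of the cover admits a local section of $\pi$ (a map $s:U\to E$ with $\pi\circ s$ equal to the inclusion $U\hookrightarrow B$); $\mathrm{secat}(\pi)=\infty$ if no such finite cover exists. *)

(* Defs.v *)
From HB Require Import structures.
From mathcomp Require Import all_boot all_order all_algebra all_fingroup all_solvable.
From mathcomp Require Import generic_quotient.
From mathcomp Require Import all_classical all_reals all_analysis.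

Set Implicit Arguments.
Unset Strict Implicit.
Unset Printing Implicit Defensive.

Import Order.TTheory GRing.Theory Num.Theory.
Import numFieldNormedType.Exports.

Local Open Scope classical_set_scope.
Local Open Scope quotient_scope.

(* The least natural number satisfying P; None stands for infinity. *)
Definition least (P : nat -> Prop) : option nat :=
  if pselect (exists n, `[< P n >]) is left exP then Some (ex_minn exP)
  else None.

Lemma least_SomeP (P : nat -> Prop) (n : nat) :
  least P = Some n <-> P n /\ forall m, P m -> n <= m.
Proof.
rewrite /least; case: pselect => [exP|nexP]; last first.
  by split=> // -[Pn _]; case: nexP; exists n; apply/asboolP.
case: ex_minnP => m /asboolP Pm minm; split=> [[<-]|[Pn minn]].
  by split=> // k Pk; apply/minm/asboolP.
by congr Some; apply/eqP; rewrite eqn_leq minn// minm//; apply/asboolP.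
Qed.

Lemma least_NoneP (P : nat -> Prop) :
  least P = None <-> forall n, ~ P n.
Proof.
rewrite /least; case: pselect => [exP|nexP].
  by split=> [//|nP]; have [n /asboolP Pn] := exP; case: (nP n).
by split=> // _ n Pn; apply: nexP; exists n; apply/asboolP.
Qed.

(* The Hausdorff condition is not included. *)
Definition paracompact (X : topologicalType) : Prop :=
  forall C : set (set X),
    C `<=` open -> \bigcup_(U in C) U = setT ->
  exists D : set (set X),
    [/\ D `<=` open, \bigcup_(V in D) V = setT,
        forall V, D V -> exists2 U, C U & V `<=` U
      & forall x : X, exists2 N : set X, nbhs x N &
          finite_set [set V | D V /\ V `&` N !=set0]].

(* Left actions of a finite (discrete) group; MathComp's {action _ &-> _} are
   right actions. *)
Record left_action (gT : finGroupType) (X : topologicalType) := LeftAction {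
  lact :> gT -> X -> X;
  lact1 : forall x, lact 1%g x = x;
  lactM : forall g h x, lact (g * h)%g x = lact g (lact h x);
  lact_continuous : forall g, continuous (lact g)
}.

Definition free_Gspace (gT : finGroupType) (X : topologicalType)
    (to : left_action gT X) : Prop :=
  hausdorff_space X /\ forall g x, to g x = x -> g = 1%g.

Section OrbitSpace.
Context {gT : finGroupType} {X : topologicalType} (to : left_action gT X).

Definition orbit_rel : rel X := fun x y => [exists g : gT, to g x == y].

Lemma orbit_rel_refl : reflexive orbit_rel.
Proof. by move=> x; apply/existsP; exists 1%g; rewrite lact1. Qed.

Lemma orbit_rel_sym : symmetric orbit_rel.
Proof.
suff sub x y : orbit_rel x y -> orbit_rel y x.
  by move=> x y; apply/idP/idP; exact: sub.
move=> /existsP[g /eqP <-]; apply/existsP; exists (g^-1)%g.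
by rewrite -lactM mulVg lact1.
Qed.

Lemma orbit_rel_trans : transitive orbit_rel.
Proof.
move=> y x z /existsP[g /eqP <-] /existsP[h /eqP <-].
by apply/existsP; exists (h * g)%g; rewrite lactM.
Qed.

Definition orbit_equiv : equiv_rel X :=
  EquivRel orbit_rel orbit_rel_refl orbit_rel_sym orbit_rel_trans.

Definition orbit_space : topologicalType :=
  quotient_topology {eq_quot orbit_equiv}.

Definition orbit_proj : X -> orbit_space :=
  \pi_(quotient_topology {eq_quot orbit_equiv}).

End OrbitSpace.

Definition has_local_section (E B : topologicalType) (pi : E -> B)
    (U : set B) : Prop :=
  exists s : U -> E, continuous s /\ forall b : U, pi (s b) = set_val b.

Definition secat (E B : topologicalType) (pi : E -> B) : option nat :=
  least (fun n => exists C : set (set B),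
    [/\ (C #= `I_n)%card, C `<=` open, \bigcup_(U in C) U = setT
      & forall U, C U -> has_local_section pi U]).

(* F(Y, l, q), as a subset of Y^l with the product topology.  The indices
   i_1 < ... < i_q are a strictly increasing map from 'I_q to 'I_l. *)
Definition config (Y : topologicalType) (l q : nat) : set {ptws 'I_l -> Y} :=
  [set y | forall i : 'I_q -> 'I_l, {homo i : a b / (a < b)%N} ->
           exists a b, y (i a) <> y (i b)].
Arguments config : clear implicits.

(* A listing g_1, ..., g_l of G together with its inverse h. *)
Record enumeration (gT : finGroupType) := Enumeration {
  elt_of : 'I_#|gT| -> gT;
  index_of : gT -> 'I_#|gT|;
  elt_ofK : cancel elt_of index_of;
  index_ofK : cancel index_of elt_of
}.

Definition tuple_act (gT : finGroupType) (e : enumeration gT) (Y : Type)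
    (g : gT) (y : 'I_#|gT| -> Y) : 'I_#|gT| -> Y :=
  fun j => y (index_of e (g^-1 * elt_of e j)%g).

(* f takes values in the subspace F(Y, l, q); the action on F(Y, l, q) being
   the restriction of that on Y^l, equivariance is an equality in Y^l. *)
Definition equivariant_map (gT : finGroupType) (e : enumeration gT)
    (X : topologicalType) (to : left_action gT X) (Y : topologicalType)
    (q : nat) (f : X -> config Y #|gT| q) : Prop :=
  continuous f /\
  forall g x, set_val (f (to g x)) = tuple_act e g (set_val (f x)).

Definition ind (R : realType) (gT : finGroupType) (e : enumeration gT)
    (q : nat) (X : topologicalType) (to : left_action gT X) : option nat :=
  least (fun k => exists f : X -> config 'rV[R]_k.+1 #|gT| q,
                    equivariant_map e to f).

(* Main.v *)
(* A local section of X -> X/G over an open set amounts to a slice: an open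
   subset of X that is disjoint from its translates by the g <> 1.  So
   secat <= n means that X is covered by the translates of n slices.

   If ind_q = 0, an equivariant map to F(R, p, q) assigns p real numbers to each
   point of X, and the set of indices at which the maximum is reached has
   between 1 and q - 1 elements.  More generally, where the k largest values are
   separated from the others, the k-subset of Z_p that carries them is locally
   constant, and Z_p acts freely on k-subsets for 0 < k < p, so that choosing
   one k-subset per orbit gives a slice.  Hence secat <= q - 1.

   Conversely, if secat <= (k + 1) (q - 1), arrange the slices S_(t,i) in k + 1
   blocks of q - 1, take continuous psi_(t,i) >= 0 vanishing off S_(t,i) whose
   translates have no common zero, and map x to the point of (R^(k+1))^G whose
   t-th coordinate at g is
     \sum_i \sum_h psi_(t,i) (h x) c_i (h g).
   This is equivariant, and as S_(t,i) is a slice the inner sum has at most one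
   nonzero term.  For generic functions c_1, ..., c_(q-1) on G, the t-th
   coordinate takes no value q times unless the t-th block vanishes at x.  Hence
   ind_q <= k. *)

Require Import Defs.
From mathcomp Require Import all_boot all_order all_algebra all_fingroup all_solvable.
From mathcomp Require Import all_classical all_reals all_analysis.
From mathcomp Require Import generic_quotient.
Import Order.TTheory GRing.Theory Num.Theory.
Import numFieldNormedType.Exports.

(** * Paracompact Hausdorff spaces: normality and bump functions *)

Section Paracompact.
Set Implicit Arguments.
Unset Strict Implicit.
Unset Printing Implicit Defensive.
Local Open Scope classical_set_scope.
Local Open Scope ring_scope.

Lemma paracompact_separation (X : topologicalType) (A B : set X) :
  paracompact X -> closed A ->
  (forall a, A a ->
    exists U : set X, [/\ open U, U a & closure U `&` B = set0]) ->
  exists W : set X, [/\ open W, A `<=` W & closure W `&` B = set0].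
Proof.
move=> pX clA sepA.
pose C := [set U : set X | open U /\
  (U `&` A !=set0 -> closure U `&` B = set0)].
have [||D [oD covD subD finD]] := pX C; first by move=> U [].
  apply/seteqP; split=> // x _.
  have [/sepA[U [oU Ux UB]]|nAx] := pselect (A x); first by exists U.
  by exists (~` A) => //; split; [rewrite openC|case=> z []].
pose W := \bigcup_(V in [set V | D V /\ V `&` A !=set0]) V.
exists W; split.
- by apply: bigcup_open => V [/oD].
- move=> a Aa; have [V DV Va] : (\bigcup_(V in D) V) a by rewrite covD.
  by exists V => //; split => //; exists a.
apply/seteqP; split=> // b [Wb Bb].
have [N Nb finN] := finD b.
(* Only the finitely many members meeting [N] matter near [b]. Their closures miss [b], so [N] minus
   [K] is a neighbourhood of [b] that should meet [W] but cannot. *)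
pose K := \bigcup_(V in [set V | [set V | D V /\ V `&` N !=set0] V /\
  V `&` A !=set0]) closure V.
have clK : closed K.
  apply: closed_bigcup => [|V _]; last exact: closed_closure.
  exact: finite_setIl.
have nKb : ~ K b.
  move=> [V [[/subD[U [_ UAB] VU] _] [z [Vz Az]]] clVb].
  suff : set0 b by [].
  rewrite -UAB; first by split => //; exact: (closureS VU).
  by exists z; split => //; exact: VU.
have [z [Wz [Nz nKz]]] : W `&` (N `&` ~` K) !=set0.
  apply: Wb; apply: filterI => //; apply: open_nbhs_nbhs; split => //.
  by rewrite openC.
have [V [DV VA] Vz] := Wz.
apply: nKz; exists V; last exact: subset_closure.
by split => //; split => //; exists z.
Qed.

Lemma closure_open_disjoint (X : topologicalType) (U V : set X) :
  open V -> U `&` V = set0 -> closure U `&` V = set0.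
Proof.
move=> oV UV; apply/disjoints_subset.
have /closure_id -> : closed (~` V) by exact: open_closedC.
by apply: closureS; exact/disjoints_subset.
Qed.

(** The separation lemma is applied twice: the Hausdorff property lets it separate [A] from each
    point of [B], and these separations let it separate [B] from [A]. *)
Lemma paracompact_normal (R : realType) (X : topologicalType) :
  hausdorff_space X -> paracompact X -> normal_space X.
Proof.
move=> hX pX; apply/(@normal_openP R) => A B clA clB AB.
have sepA b : B b ->
    exists W : set X, [/\ open W, A `<=` W & closure W `&` [set b] = set0].
  move=> Bb; apply: paracompact_separation => // a Aa.
  move: hX; rewrite open_hausdorff => /(_ a b)[|[U V]/=].
    by apply: contraPneq Aa => -> Ab; have : set0 b by rewrite -AB.
  rewrite !inE => -[Ua Vb] [oU oV UV]; exists U; split => //.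
  rewrite -subset0 => z [clUz zb]; rewrite -(closure_open_disjoint oV UV).
  by split => //; rewrite zb.
have [b Bb|W [oW BW WA]] := @paracompact_separation _ B A pX clB.
  have [W [oW AW Wb]] := sepA _ Bb.
  exists (~` closure W); split.
  - by rewrite openC; exact: closed_closure.
  - by move=> clWb; have : set0 b by rewrite -Wb.
  - rewrite -subset0 => a [cla /AW Wa].
    rewrite -(@closure_open_disjoint _ (~` closure W) W) //.
    rewrite setIC; apply/disjoints_subset; rewrite setCK.
    exact: subset_closure.
exists (~` closure W), W; split => //.
- by rewrite openC; exact: closed_closure.
- by apply/disjoints_subset; rewrite setIC.
- rewrite setIC; apply/disjoints_subset; rewrite setCK.
  exact: subset_closure.
Qed.

(** The indices are treated one at a time. The invariant is a mixed cover: nonvanishing sets of the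
    functions already built, and the original [V i] for the other indices. *)
Lemma normal_bump_functions (R : realType) (X : topologicalType) (I : finType)
    (V : I -> set X) : normal_space X ->
  (forall i, open (V i)) -> (forall x, exists i, V i x) ->
  exists phi : I -> X -> R,
    [/\ forall i, continuous (phi i), forall i x, 0 <= phi i x,
        forall i x, phi i x != 0 -> V i x
      & forall x, exists i, phi i x != 0].
Proof.
move=> nX oV covV.
suff /(_ (enum I) (enum_uniq I))[phi [cphi phi0 phiV covphi]] (s : seq I) :
    uniq s -> exists phi : I -> X -> R,
    [/\ forall i, continuous (phi i), forall i x, 0 <= phi i x,
        forall i x, phi i x != 0 -> V i x
      & forall x, exists i, if i \in s then phi i x != 0 : Prop else V i x].
  exists phi; split => // x; have [i] := covphi x.
  by rewrite mem_enum; exists i.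
elim: s => [_|i s IHs /= /andP[nis us]].
  exists (fun _ _ => 0); split => //; first by move=> _; exact: cst_continuous.
  by move=> ? ?; rewrite eqxx.
have [phi [cphi phi0 phiV covphi]] := IHs us.
pose U j := if j \in s then [set x | phi j x != 0] else V j.
have oU j : open (U j).
  rewrite /U; case: ifP => // _.
  by apply: (@open_comp _ _ (phi j) [set y : R | y != 0]) => [x _|];
    [exact: cphi|exact: open_neq].
(* [A] is what the other members leave uncovered, hence a closed subset of [V i]. A Urysohn function
   equal to 1 on [A] and 0 off [V i] keeps the cover. *)
pose A := ~` \bigcup_(j in [set j | j != i]) U j.
have clA : closed A by apply: open_closedC; exact: bigcup_open.
have AV : ~` V i `&` A = set0.
  rewrite -subset0 => x [nVx Ax]; have [j] := covphi x.
  have [->|ji Uj] := eqVneq j i; first by rewrite (negbTE nis).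
  by apply: Ax; exists j => //; rewrite /U; case: ifP Uj.
have [f [cf f0 f1 f01]] := @urysohn_ext_itv _ R nX _ _ 0 1
  (open_closedC (oV i)) clA AV ltr01.
exists (fun j => if j == i then f else phi j); split.
- by move=> j; case: ifP => _; [exact: cf|exact: cphi].
- move=> j x; case: ifP => _ //.
  have := f01 (f x) (ex_intro2 _ _ x Logic.I erefl).
  by rewrite /= in_itv/= => /andP[].
- move=> j x; have [->|_] := eqVneq j i; last exact: phiV.
  by move=> fx; apply: contrapT => nVx; case/eqP: fx; apply: f0; exists x.
- move=> x; have [Ax|] := pselect (A x).
    exists i; rewrite inE eqxx /= (f1 (f x)) ?oner_neq0 //; by exists x.
  rewrite /A /= notK => -[j/= ji Ujx]; exists j.
  by rewrite inE (negbTE ji) /=; move: Ujx; rewrite /U; case: ifP.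
Qed.

End Paracompact.

(** * Slices of a free action and local sections of the orbit projection *)

Section Slices.
Set Implicit Arguments.
Unset Strict Implicit.
Unset Printing Implicit Defensive.
Local Open Scope classical_set_scope.
Context {gT : finGroupType} {X : topologicalType} (to : left_action gT X).

Definition slice (S : set X) : Prop :=
  open S /\ forall g x, S x -> S (to g x) -> g = 1%g.

Lemma orbit_projP x y :
  orbit_proj to x = orbit_proj to y <-> exists g, to g x = y.
Proof.
split=> [/eqmodP/existsP[g /eqP xy]|[g xy]]; first by exists g.
by apply/eqmodP/existsP; exists g; apply/eqP.
Qed.

Lemma orbit_proj_act g x : orbit_proj to (to g x) = orbit_proj to x.
Proof. by apply/esym/orbit_projP; exists g. Qed.

Lemma orbit_proj_continuous : continuous (orbit_proj to).
Proof. exact: pi_continuous. Qed.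

Lemma open_lact_preimage g (N : set X) : open N -> open (to g @^-1` N).
Proof. by move=> oN; apply: open_comp => // x _; exact: lact_continuous. Qed.

Lemma orbit_proj_open (N : set X) : open N -> open (orbit_proj to @` N).
Proof.
move=> oN; suff : open (orbit_proj to @^-1` (orbit_proj to @` N)) by [].
suff -> : orbit_proj to @^-1` (orbit_proj to @` N) =
    \bigcup_(g in [set: gT]) (to g @^-1` N).
  by apply: bigcup_open => g _; exact: open_lact_preimage.
apply/seteqP; split=> [x /= [y Ny /esym/orbit_projP[g gxy]]|x [g _ /= Ngx]].
  by exists g => //=; rewrite gxy.
by exists (to g x) => //; exact: orbit_proj_act.
Qed.

(** Each orbit over the image of [S] meets [S] exactly once, which defines the section. It is
    continuous because the projection is open: near [b0] the lift stays in [N] over the image of [N]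
    intersected with [S]. *)
Lemma slice_section (S : set X) :
  slice S -> has_local_section (orbit_proj to) (orbit_proj to @` S).
Proof.
move=> [oS Sfree].
have /choice[s sP] (b : orbit_proj to @` S) :
    exists x, S x /\ orbit_proj to x = set_val b.
  by have [x Sx xb] := set_valP b; exists x.
exists s; split=> [b0 A|b]; last by have [] := sP b.
rewrite nbhsE => -[N [oN Nb0] NA].
pose O := orbit_proj to @` (N `&` S).
exists (set_val @^-1` O); split.
- by exists O => //; apply: orbit_proj_open; exact: openI.
- by exists (s b0); [split => //|]; have [] := sP b0.
- move=> b [y [Ny Sy] yb]; apply: NA; have [Ssb] := sP b.
  rewrite -yb => /esym/orbit_projP[g gys].
  by move: gys Ssb => <- /(Sfree _ _ Sy) ->; rewrite lact1.
Qed.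

(** The slice is the range of the section [s]; freeness makes it disjoint from its translates, and
    the real point is that it is open. A point [x] near [s b0] is [h] times [s b] for some [h], and
    the Hausdorff property rules out every nontrivial [h]. *)
Lemma section_slice (U : set (orbit_space to)) :
  free_Gspace to -> open U -> has_local_section (orbit_proj to) U ->
  exists S, slice S /\ forall x, U (orbit_proj to x) -> exists g, S (to g x).
Proof.
move=> [hX free] oU [s [cs sK]]; exists (range s); split; first split.
- rewrite openE => _ [b0 _ <-].
  (* For nontrivial [h], [P h] pairs a neighbourhood of [s b0] with one of its orbit over which [h]
     times the section avoids the former. The pair for the identity is a dummy. *)
  have /choice[P oP] (h : gT) : exists P : set X * set (orbit_space to),
      h != 1%g -> [/\ open P.1, P.1 (s b0), open P.2, P.2 (set_val b0)
      & forall b : U, P.2 (set_val b) -> ~ P.1 (to h (s b))].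
    have [->|h1] := eqVneq h 1%g; first by exists (setT, setT).
    have hs : s b0 != to h (s b0).
      by apply: contraNneq h1 => /esym/free ->.
    move: hX; rewrite open_hausdorff => /(_ _ _ hs)[[A B]/=].
    rewrite !inE => -[As Bs] [oA oB AB].
    have : nbhs b0 (s @^-1` (to h @^-1` B)).
      apply: cs; apply: open_nbhs_nbhs; split => //.
      exact: open_lact_preimage.
    move=> [_ [[W oW <-] Wb0] WB]; exists (A, W) => _; split => //= b Wb Ahb.
    have : (A `&` B) (to h (s b)) by split => //; exact: (WB b).
    by rewrite AB.
  have : \forall x \near s b0, U (orbit_proj to x) /\
      forall h, h != 1%g -> (P h).1 x /\ (P h).2 (orbit_proj to x).
    have nU : \forall x \near s b0, U (orbit_proj to x).
      apply: orbit_proj_continuous; apply: open_nbhs_nbhs; split => //.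
      by rewrite sK; exact: set_valP.
    have nP h : \forall x \near s b0, h != 1%g ->
        (P h).1 x /\ (P h).2 (orbit_proj to x).
      have [_|/oP [? P1 ? P2 _]] := eqVneq h 1%g; first exact: nearW.
      near=> x => _; split; near: x; first exact: open_nbhs_nbhs.
      apply: orbit_proj_continuous; apply: open_nbhs_nbhs; split => //.
      by rewrite sK.
    near=> x; split; first by near: x.
    by near: x; exact: filter_forall.
  apply: filterS => x [Ux Px].
  pose b : U := SigSub (mem_set Ux).
  have /orbit_projP[h hsb] : orbit_proj to (s b) = orbit_proj to x.
    by rewrite sK.
  have [h1|h1] := eqVneq h 1%g; first by exists b; rewrite // -hsb h1 lact1.
  have [P1 P2] := Px h h1; have [_ _ _ _ /(_ b P2)] := oP h h1.
  by rewrite hsb.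
- move=> g _ [b _ <-] [c _ cb].
  suff bc : b = c by apply: (free g (s b)); rewrite -cb bc.
  by apply: val_inj; rewrite -[LHS]sK -[RHS]sK cb orbit_proj_act.
- move=> x Ux; pose b : U := SigSub (mem_set Ux).
  have /orbit_projP[h hsb] : orbit_proj to x = orbit_proj to (s b).
    by rewrite sK.
  by exists h; exists b.
Unshelve. all: by end_near. Qed.

Lemma secat_slices n :
  free_Gspace to -> secat (orbit_proj to) = Some n ->
  exists S : 'I_n -> set X,
    (forall i, slice (S i)) /\ forall x, exists i g, S i (to g x).
Proof.
move=> free /least_SomeP[[C [Cn oC covC secC]] _].
have /card_set_bijP[U [UC _ surjU]] : (`I_n #= C)%card by rewrite card_esym.
have /choice[S sliceS] (i : 'I_n) : exists S, slice S /\
    forall x, U i (orbit_proj to x) -> exists g, S (to g x).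
  have CU : C (U i) by apply: UC; exact: ltn_ord.
  by apply: section_slice => //; [exact: oC|exact: secC].
exists S; split=> [i|x]; first by have [] := sliceS i.
have [V CV Vx] : (\bigcup_(V in C) V) (orbit_proj to x) by rewrite covC.
have [i /= ltin UiV] := surjU _ CV.
have [_ /(_ x)[]] := sliceS (Ordinal ltin); first by rewrite /= UiV.
by move=> g Sgx; exists (Ordinal ltin), g.
Qed.

Lemma slices_secat m n (S : 'I_m -> set X) :
  (forall i, slice (S i)) -> (forall x, exists i g, S i (to g x)) ->
  secat (orbit_proj to) = Some n -> (n <= m)%N.
Proof.
move=> sliceS covS /least_SomeP[_ minn].
pose C := range (fun i => orbit_proj to @` S i).
have leC : (C #<= `I_m)%card.
  by rewrite (card_le_eqr card_II); exact: card_image_le.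
(* Different slices may have the same image, so the cover has some cardinality [k] at most [m], not
   necessarily [m]. *)
have /finite_setP[k Ck] : finite_set C by apply/finite_set_leP; exists m.
suff /minn nk : exists C : set (set (orbit_space to)),
    [/\ (C #= `I_k)%card, C `<=` open, \bigcup_(U in C) U = setT
      & forall U, C U -> has_local_section (orbit_proj to) U].
  by apply: leq_trans nk _; rewrite -card_le_II -(card_le_eql Ck).
exists C; split => //.
- by move=> _ [i _ <-]; apply: orbit_proj_open; have [] := sliceS i.
- apply/seteqP; split=> // b _; rewrite -[b]reprK.
  have [i [g Sx]] := covS (repr b); exists (orbit_proj to @` S i).
    by exists i.
  by exists (to g (repr b)) => //; exact: orbit_proj_act.
- by move=> _ [i _ <-]; exact: slice_section.
Qed.

End Slices.

(** * Generic real functions on a finite set *)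

Section GenericFunctions.
Set Implicit Arguments.
Unset Strict Implicit.
Unset Printing Implicit Defensive.
Local Open Scope ring_scope.
Variables (R : numFieldType) (T : finType).

Lemma exists_nonroot (p : {poly R}) : p != 0 -> exists x, p.[x] != 0.
Proof.
move=> p0; pose s := [seq i%:R : R | i <- iota 0 (size p)].
have : ~~ all (root p) s.
  apply/negP => /(max_poly_roots p0); rewrite size_map size_iota ltnn.
  rewrite map_inj_uniq ?iota_uniq //; first by move/(_ isT).
  exact: mulrIn (oner_neq0 R).
by move=> /allPn[x _ px]; exists x.
Qed.

(** The row of ones absorbs a common value [v]: the relations of [generic_functions] say that the
    row vector with entries [- v] and then the [a i] is in the left kernel. *)
Definition bordered_mx (c : nat -> T -> R) r (s : nat -> 'I_r.+1 -> T) :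
    'M[R]_r.+1 :=
  \matrix_(i, k) (if i == 0%N :> nat then 1 else c i (s i k)).

(* Expanding along the last row, the determinant is a nonzero polynomial in x
   once the last function is t |-> x ^+ enum_rank t; there are finitely many
   such polynomials, so some x is a root of none of them. *)
Lemma generic_bordered_det r : exists c : nat -> T -> R,
  forall s : nat -> 'I_r.+1 -> T, (forall i, injective (s i)) ->
    \det (bordered_mx c s) != 0.
Proof.
elim: r => [|r [c cP]].
  by exists (fun _ _ => 0) => s _; rewrite det_mx11 mxE oner_neq0.
pose inj2 (s : {ffun 'I_r.+2 -> {ffun 'I_r.+2 -> T}}) :=
  [forall i, injectiveb (s i)].
pose A (s : {ffun 'I_r.+2 -> {ffun 'I_r.+2 -> T}}) :=
  bordered_mx c (fun i => s (inord i)).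
pose P s := \sum_k cofactor (A s) ord_max k *:
  'X^(enum_rank (s ord_max k)) : {poly R}.
have cofE s k : cofactor (A s) ord_max k = (-1) ^+ (r.+1 + k) *
    \det (bordered_mx c (fun i (j : 'I_r.+1) => s (inord i) (lift k j))).
  rewrite /cofactor; congr (_ * \det _); apply/matrixP => i j.
  by rewrite !mxE lift_max.
have P0 s : inj2 s -> P s != 0.
  move=> /forallP sinj.
  have sI i : injective (s i) by exact/injectiveP.
  (* Since [s ord_max] is injective, the exponents are distinct and this coefficient is a single
     cofactor, nonzero by the induction hypothesis. *)
  suff : (P s)`_(enum_rank (s ord_max ord0)) != 0.
    by apply: contraNneq => ->; rewrite coef0.
  rewrite coef_sum (bigD1 ord0) //= big1 => [|k k0].
    rewrite coefZ coefXn eqxx mulr1 addr0 cofE mulf_neq0 ?signr_eq0 //.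
    by apply: cP => i j k /sI /lift_inj.
  rewrite coefZ coefXn; case: eqP => [/ord_inj/enum_rank_inj/sI E|_].
    by rewrite -E eqxx in k0.
  by rewrite mulr0.
have [x] : exists x, (\prod_(s | inj2 s) P s).[x] != 0.
  by apply: exists_nonroot; apply/prodf_neq0 => s; exact: P0.
rewrite horner_prod => /prodf_neq0 Px.
exists (fun i t => if i == r.+1 then x ^+ enum_rank t else c i t) => s sinj.
pose f := [ffun i : 'I_r.+2 => [ffun k => s i k]].
have finj : inj2 f.
  by apply/forallP => i; apply/injectiveP => j k; rewrite !ffunE => /sinj.
have := Px f finj; congr (_ != 0); rewrite /P horner_sum.
rewrite (expand_det_row _ ord_max); apply: eq_bigr => k _.
rewrite hornerZ hornerXn !mxE /= eqxx !ffunE mulrC; congr (_ * _).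
rewrite cofE /cofactor; congr (_ * \det _); apply/matrixP => i j.
have ir : (i < r.+2)%N by rewrite ltnS ltnW.
rewrite !mxE lift_max !ffunE inordK //.
by rewrite (ltn_eqF (ltn_ord i)).
Qed.

Lemma generic_functions r : exists c : 'I_r -> T -> R,
  forall (s : 'I_r -> 'I_r.+1 -> T) (a : 'I_r -> R) (v : R),
    (forall i, injective (s i)) ->
    (forall k, \sum_i a i * c i (s i k) = v) -> forall i, a i = 0.
Proof.
have [c cP] := generic_bordered_det r.
exists (fun i => c i.+1) => s a v sinj av i.
pose s' n := s (insubd i n.-1).
pose u : 'rV_r.+1 := \row_k oapp a (- v) (unlift ord0 k).
have s'E (j : 'I_r) : s' j.+1 = s j by rewrite /s' /= valKd.
have : u == 0.
  apply: contraTT (cP s' (fun n => sinj (insubd i n.-1))) => u0; rewrite negbK.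
  apply/det0P; exists u => //; apply/rowP => k; rewrite !mxE big_ord_recl.
  rewrite !mxE unlift_none mulr1 -(av k) addrC; apply/eqP; rewrite subr_eq0.
  by apply/eqP/eq_bigr => j _; rewrite !mxE liftK /= s'E.
by move=> /eqP/rowP/(_ (lift ord0 i)); rewrite !mxE liftK.
Qed.

End GenericFunctions.

(** * From slices to an equivariant map *)

Section UpperBound.
Set Implicit Arguments.
Unset Strict Implicit.
Unset Printing Implicit Defensive.
Local Open Scope classical_set_scope.
Local Open Scope ring_scope.

Lemma continuous_ptws (X Y : topologicalType) l (g : X -> {ptws 'I_l -> Y}) :
  (forall j, continuous (fun x => g x j)) -> continuous g.
Proof.
move=> cg x; apply/cvg_sup => j A [_ [[B oB <-] Bgx] BA].
by apply: filterS BA _; apply: cg; exact: open_nbhs_nbhs.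
Qed.

Lemma continuous_mx (X T : topologicalType) m n (g : X -> 'M[T]_(m, n)) :
  (forall i j, continuous (fun x => g x i j)) -> continuous g.
Proof.
move=> cg x A [P Pg PA].
have : \forall y \near x, forall i j, P i j (g y i j).
  by do 2!apply: filter_forall => ?; apply: cg; exact: Pg.
by apply: filterS => y; exact: PA.
Qed.

Lemma config_corestriction (X Y : topologicalType) l q
    (g : X -> {ptws 'I_l -> Y}) :
  (forall x, config Y l q (g x)) -> continuous g ->
  exists f : X -> config Y l q, continuous f /\ forall x, set_val (f x) = g x.
Proof.
move=> gP cg; exists (fun x => SigSub (mem_set (gP x))); split => // x A.
move=> [_ [[B oB <-] Bgx] BA].
by apply: filterS BA _; apply: (cg x); exact: open_nbhs_nbhs.
Qed.

Lemma equivariant_map_of_slices (R : realType) (gT : finGroupType)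
    (e : enumeration gT) (X : topologicalType) (to : left_action gT X)
    (n k r : nat) (S : 'I_n -> set X) :
  normal_space X -> (forall i, slice to (S i)) ->
  (forall x, exists i g, S i (to g x)) -> (n <= k.+1 * r)%N ->
  exists f : X -> config 'rV[R]_k.+1 #|gT| r.+1, equivariant_map e to f.
Proof.
move=> nX sliceS covS nkr.
pose J := ('I_k.+1 * 'I_r)%type.
have cardJ : #|{: J}| = (k.+1 * r)%N by rewrite card_prod !card_ord.
(* The [n] slices are padded with empty ones to fill all [k.+1] blocks of [r]. *)
pose S' (j : J) := oapp S set0 (insub (enum_rank j : nat)).
have sliceS' j : slice to (S' j).
  rewrite /S'; case: insub => [i|] /=; first exact: sliceS.
  by split=> //; exact: open0.
have covS' x : exists jg : J * gT, (to jg.2 @^-1` S' jg.1) x.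
  have [i [g Sgx]] := covS x.
  have iJ : (i < #|{: J}|)%N by rewrite cardJ; exact: leq_trans nkr.
  by exists (enum_val (Ordinal iJ), g); rewrite /S' /= enum_valK /= valK.
have [||phi [cphi phi0 phiS covphi]] :=
  @normal_bump_functions R X _ (fun jg : J * gT => to jg.2 @^-1` S' jg.1) nX.
- by move=> [j g]; apply: open_lact_preimage; have [] := sliceS' j.
- exact: covS'.
(* [phi (j, h)] lives on a translate of the slice [S' j]; each summand is moved back, so [psi j]
   vanishes off [S' j], and nonnegativity prevents cancellation. *)
pose psi j x := \sum_h phi (j, h) (to h^-1%g x).
have cpsi j : continuous (psi j).
  apply: continuous_big => [|h _ x]; first exact: add_continuous.
  by apply: continuous_comp; [exact: lact_continuous|exact: cphi].
have psiS j x : psi j x != 0 -> S' j x.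
  move=> /eqP; apply: contra_notP => nSx; apply: big1 => h _.
  apply/eqP; apply/negPn/negP => /phiS /=.
  by rewrite -lactM mulgV lact1.
have covpsi x : exists j h, psi j (to h x) != 0.
  have [[j h] phix] := covphi x; exists j, h.
  rewrite gt_eqF // /psi (bigD1 h) //= -lactM mulVg lact1 ltr_pwDl //.
    by rewrite lt_neqAle eq_sym phix phi0.
  exact: sumr_ge0.
have psi_uniq j x h h' : psi j (to h x) != 0 -> psi j (to h' x) != 0 -> h = h'.
  move=> /psiS Sx /psiS Shx; have [_ /(_ (h' * h^-1)%g _ Sx)] := sliceS' j.
  by rewrite -lactM mulgKV => /(_ Shx)/divg1_eq ->.
have [c cP] := generic_functions R gT r.
pose F x g t := \sum_i \sum_h psi (t, i) (to h x) * c i (h * g)%g.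
have FM h x g t : F (to h x) g t = F x (h^-1 * g)%g t.
  apply: eq_bigr => i _.
  rewrite (reindex_inj (mulIg h^-1)%g) /=; apply: eq_bigr => h' _.
  by rewrite -lactM mulgKV mulgA.
have cF g t : continuous (fun x => F x g t).
  apply: continuous_big => [|i _]; first exact: add_continuous.
  apply: continuous_big => [|h _ x]; first exact: add_continuous.
  apply: cvgM; last exact: cvg_cst.
  by apply: continuous_comp; [exact: lact_continuous|exact: cpsi].
pose G x : {ptws 'I_#|gT| -> 'rV[R]_k.+1} := fun j => \row_t F x (elt_of e j) t.
have cG : continuous G.
  apply: continuous_ptws => j; apply: continuous_mx => i t.
  by under eq_fun do rewrite mxE; exact: cF.
have GP x : config 'rV[R]_k.+1 #|gT| r.+1 (G x).
  move=> i imono; apply: contrapT => coinc.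
  have [[t i0] [h0 psi0]] := covpsi x.
  (* [h j] is the only element that can move [x] to where [psi (t, j)] is nonzero; it defaults to
     the identity if there is none. *)
  have /choice[h hP] (j : 'I_r) : exists h : gT, forall h', h' != h ->
      psi (t, j) (to h' x) = 0.
    have [[h ph]|nh] := pselect (exists h, psi (t, j) (to h x) != 0).
      exists h => h' h'h; apply/eqP; apply: contraNT h'h => ph'.
      exact/eqP/(psi_uniq _ _ _ _ ph').
    by exists 1%g => h' _; apply/eqP; apply: contra_notT nh => ?; exists h'.
  have h0E : h0 = h i0.
    by apply/eqP; apply: contraNT psi0 => /hP ->.
  have FE g : F x g t = \sum_i psi (t, i) (to (h i) x) * c i (h i * g)%g.
    apply: eq_bigr => j _; rewrite (bigD1 (h j)) //= big1 ?addr0 // => h' h'h.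
    by rewrite hP // mul0r.
  have iinj : injective i.
    by move=> a b iab; apply/val_inj; case: (ltngtP a b) => // /imono;
      rewrite iab ltnn.
  move/eqP: psi0; apply; rewrite h0E.
  (* A coincidence at [r.+1] indices gives [r.+1] equal values of the [t]-th coordinate. Genericity
     then kills all coefficients of block [t], including the nonzero one at [i0]. *)
  apply: (cP (fun j a => h j * elt_of e (i a))%g
    (fun j => psi (t, j) (to (h j) x)) (F x (elt_of e (i ord0)) t))
    => [j a b|a].
    by move=> /mulgI/(can_inj (elt_ofK e))/iinj.
  rewrite -FE; apply: contrapT => neq; apply: coinc; exists a, ord0.
  by move=> /rowP/(_ t); rewrite !mxE.
have [f [cf fG]] := config_corestriction GP cG.
exists f; split => // g x; rewrite !fG; apply/funext => j; apply/rowP => t.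
by rewrite /tuple_act /G !mxE FM index_ofK.
Qed.
End UpperBound.

(** * From an equivariant map into the real line's configurations to slices *)

Section LowerBound.
Set Implicit Arguments.
Unset Strict Implicit.
Unset Printing Implicit Defensive.
Local Open Scope classical_set_scope.
Local Open Scope ring_scope.

Lemma increasing_enumeration n q (A : {set 'I_n}) : (q <= #|A|)%N ->
  exists i : 'I_q -> 'I_n, {homo i : a b / (a < b)%N} /\ forall a, i a \in A.
Proof.
case: q => [|q] qA; first by exists (widen_ord (leq0n n)); split => -[].
have /card_gt0P[x0 _] : (0 < #|A|)%N by apply: leq_trans qA.
have sA (k : 'I_q.+1) : (k < size (enum A))%N.
  by rewrite -cardE; exact: leq_trans (ltn_ord k) qA.
exists (fun k => nth x0 (enum A) k); split=> [a b ab|a]; last first.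
  by rewrite -mem_enum mem_nth.
apply: (@sorted_ltn_nth _ (fun i j : 'I_n => (i < j)%N)) => //; last exact: sA.
- by move=> ? ? ?; exact: ltn_trans.
- rewrite /enum_mem sorted_filter //; first by move=> ? ? ?; exact: ltn_trans.
  rewrite -enumT; have := iota_ltn_sorted 0 n.
  by rewrite -val_enum_ord sorted_map.
- exact: sA.
Qed.

Section TranslatesOfSubsets.
Variable gT : finGroupType.
Local Open Scope group_scope.

(** A canonical representative of the orbit of [A] under left translation: [choose] gives the same
    result for all members of the orbit, as their predicates agree extensionally. *)
Definition subset_repr (A : {set gT}) : {set gT} :=
  choose [pred B : {set gT} | [exists h, B == mulg h @: A]] A.

Lemma imset_mulgM (h k : gT) (A : {set gT}) :
  mulg h @: (mulg k @: A) = mulg (h * k) @: A.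
Proof. by rewrite -imset_comp; apply: eq_imset => x /=; rewrite mulgA. Qed.

Lemma imset_mulg1 (A : {set gT}) : mulg 1 @: A = A.
Proof. by rewrite (eq_imset _ (@mul1g _)) imset_id. Qed.

Lemma subset_reprP A : exists h, subset_repr A = mulg h @: A.
Proof.
have PA : [exists h, A == mulg h @: A].
  by apply/existsP; exists 1; rewrite imset_mulg1.
have /existsP[h /eqP rA] :=
  @chooseP _ [pred B : {set gT} | [exists h, B == mulg h @: A]] A PA.
by exists h.
Qed.

Lemma subset_repr_mulg (h : gT) (A : {set gT}) :
  subset_repr (mulg h @: A) = subset_repr A.
Proof.
rewrite /subset_repr.
have PE : [pred B : {set gT} | [exists k, B == mulg k @: (mulg h @: A)]] =1
          [pred B : {set gT} | [exists k, B == mulg k @: A]].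
  move=> B /=; apply/existsP/existsP => -[k /eqP ->].
    by exists (k * h); rewrite imset_mulgM.
  by exists (k * h^-1); rewrite imset_mulgM mulgKV.
rewrite (eq_choose PE); apply: choose_id => /=.
  by apply/existsP; exists h.
by apply/existsP; exists 1; rewrite imset_mulg1.
Qed.

(** In a group of prime order a nontrivial [h] generates, so a nonempty set stable under [h] is the
    whole group. *)
Lemma prime_translate_id h (A : {set gT}) : prime #|gT| -> A != finset.set0 ->
  (#|A| < #|gT|)%N -> mulg h @: A = A -> h = 1.
Proof.
move=> pr /set0Pn[a Aa] ltA hA; apply/eqP; apply: contraTT ltA => h1.
suff -> : A = [set: gT]%SET by rewrite cardsT ltnn.
have genh : <[h]> = [set: gT]%SET.
  apply/eqP; rewrite eqEcard finset.subsetT cardsT /= -orderE.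
  have := order_dvdG (finset.in_setT h); rewrite cardsT => /(primeP pr).2.
  by rewrite order_eq1 (negbTE h1) => /eqP ->.
have powh n : h ^+ n * a \in A.
  elim: n => [|n IHn]; first by rewrite mul1g.
  by rewrite expgS -mulgA -hA; apply: imset_f.
apply/setP => x; rewrite inE.
have /cycleP[n xa] : x * a^-1 \in <[h]> by rewrite genh inE.
by rewrite -(mulgKV a x) xa powh.
Qed.

End TranslatesOfSubsets.

Lemma slices_of_equivariant_map (R : realType) (gT : finGroupType)
    (e : enumeration gT) (X : topologicalType) (to : left_action gT X) (q : nat)
    (f : X -> config 'rV[R]_1 #|gT| q) :
  prime #|gT| -> (q <= #|gT|)%N -> equivariant_map e to f ->
  exists S : 'I_q.-1 -> set X,
    (forall i, slice to (S i)) /\ forall x, exists i g, S i (to g x).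
Proof.
move=> pr qp [cf feq].
pose F x g : R := (set_val (f x) : {ptws _ -> _}) (index_of e g) ord0 ord0.
have FM h x g : F (to h x) g = F x (h^-1 * g)%g.
  by rewrite /F feq /tuple_act index_ofK.
have cF g : continuous (fun x => F x g).
  move=> x; apply: (@continuous_comp _ _ _
    (fun x => (set_val (f x) : {ptws _ -> _}) (index_of e g))
    (fun M => M ord0 ord0)).
    apply: (@continuous_comp _ _ _ (fun x => set_val (f x) : {ptws _ -> _})
      (fun y => y (index_of e g))); last exact: proj_continuous.
    apply: (@continuous_comp _ _ _ f set_val); first exact: cf.
    exact: initial_continuous.
  exact: coord_continuous.
pose top (A : {set gT}) := [set x |
  forall a b, a \in A -> b \notin A -> F x b < F x a].
have otop A : open (top A).
  rewrite openE => x Ax.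
  have : \forall y \near x, forall a, forall b,
      a \in A -> b \notin A -> F y b < F y a.
    apply: filter_forall => a; apply: filter_forall => b.
    have [aA|_] := boolP (a \in A); last exact: nearW.
    have [_|bA] := boolP (b \in A); first exact: nearW.
    have : nbhs x ((fun y => F y a - F y b) @^-1` [set z | 0 < z]).
      apply: (cvgB (cF a x) (cF b x)); apply: open_nbhs_nbhs; split.
        exact: open_gt.
      by rewrite /= subr_gt0; exact: Ax.
    by apply: filterS => y; rewrite /= subr_gt0.
  by apply: filterS.
have topM h A x : top A x -> top (mulg h @: A) (to h x).
  move=> Ax a b /imsetP[a' Aa' ->] bA; rewrite !FM mulKg; apply: Ax => //.
  apply: contraNN bA => bA; apply/imsetP; exists (h^-1 * b)%g => //.
  by rewrite mulKVg.
(* Otherwise, by equality of sizes, there are [a] in [A] but not [B] and [b] in [B] but not [A], and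
   each of their values would exceed the other. *)
have top_uniq (A B : {set gT}) x : #|A| = #|B| -> top A x -> top B x -> A = B.
  move=> cAB Ax Bx; apply/eqP; rewrite eqEcard cAB leqnn andbT.
  apply/subsetPn => -[a aA aB].
  have : ~~ (B \subset A).
    apply/negP => BA; have : B == A by rewrite eqEcard BA cAB leqnn.
    by move=> /eqP BAE; rewrite BAE aA in aB.
  move=> /subsetPn[b bB bA].
  by have := lt_trans (Ax _ _ aA bA) (Bx _ _ bB aB); rewrite ltxx.
(* The shift to [k.+1] makes the sizes run from 1 to [q.-1]. If [x] and [g x] both lie in [S k],
   then [g] maps one representative to another of the same orbit, so it fixes it and is trivial. *)
pose S (k : 'I_q.-1) := \bigcup_(A in [set A : {set gT} |
  #|A| = k.+1 /\ subset_repr A = A]) top A.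
exists S; split=> [k|x].
  split; first by exact: bigcup_open.
  move=> g x [A [cA rA] Ax] [B [cB rB] Bgx].
  have AB : mulg g @: A = B.
    apply: (top_uniq _ _ (to g x)) => //; last exact: topM.
    by rewrite card_imset ?cA ?cB //; exact: mulgI.
  apply: (@prime_translate_id _ g A) => //.
  - by rewrite -card_gt0 cA.
  - by rewrite cA; apply: leq_trans qp; rewrite -ltn_predRL.
  - by rewrite AB -rB -AB subset_repr_mulg.
pose A := [set g | [forall g', F x g' <= F x g]]%SET.
have A0 : (0 < #|A|)%N.
  apply/card_gt0P; case: (@arg_maxP _ _ _ 1%g xpredT (F x) isT) => g _ gmax.
  by exists g; rewrite inE; apply/forallP => g'; exact: gmax.
have Ax : top A x.
  move=> a b; rewrite !inE => /forallP amax /forallPn[g]; rewrite -ltNge.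
  by move=> /lt_le_trans; apply.
(* With [q] maximizers, the increasing list of their indices would give [q] equal entries, which
   [config] forbids. *)
have Aq : (#|A| < q)%N.
  rewrite ltnNge; apply/negP => qA.
  have [|i [imono iA]] :=
    @increasing_enumeration _ q [set j | elt_of e j \in A]%SET.
    suff -> : [set j | elt_of e j \in A]%SET = index_of e @: A.
      by rewrite card_imset //; exact: can_inj (index_ofK e).
    apply/setP => j; rewrite inE; apply/idP/imsetP => [jA|[g gA ->]].
      by exists (elt_of e j); rewrite ?elt_ofK.
    by rewrite index_ofK.
  have [a [b]] := set_valP (f x) i imono; apply.
  apply/rowP => j; rewrite ord1; apply/eqP.
  have FA c : F x (elt_of e (i c)) =
      (set_val (f x) : {ptws _ -> _}) (i c) ord0 ord0 by rewrite /F elt_ofK.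
  have := iA a; have := iA b; rewrite !inE => /forallP bmax /forallP amax.
  by rewrite eq_le -!FA amax bmax.
have [h rA] := subset_reprP A.
have Aq' : (#|A|.-1 < q.-1)%N by rewrite -ltnS !prednK // (leq_trans _ Aq).
exists (Ordinal Aq'), h, (mulg h @: A); last exact: topM.
split; first by rewrite card_imset ?prednK //; exact: mulgI.
by rewrite subset_repr_mulg.
Qed.
End LowerBound.

(** * Numerical bounds and the case analysis *)

Lemma least_le (P : nat -> Prop) (k : nat) :
  P k -> exists2 d, least P = Some d & (d <= k)%N.
Proof.
case E: (least P) => [d|] Pk; last by have /least_NoneP/(_ k) := E.
by exists d => //; have /least_SomeP[_] := E; apply.
Qed.

Lemma ind_le_secat (R : realType) (gT : finGroupType) (e : enumeration gT)
    (X : topologicalType) (to : left_action gT X) (q n k : nat) :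
  free_Gspace to -> paracompact X -> (0 < q)%N ->
  secat (orbit_proj to) = Some n -> (n <= k.+1 * q.-1)%N ->
  exists2 d, ind R e q to = Some d & (d <= k)%N.
Proof.
case: q => // r free pX _ secn nkr; apply: least_le.
have [S [sliceS covS]] := secat_slices free secn.
apply: (equivariant_map_of_slices _ _ _ sliceS covS nkr).
by apply: (@paracompact_normal R) => //; case: free.
Qed.

Lemma secat_le_ind0 (R : realType) (gT : finGroupType) (e : enumeration gT)
    (X : topologicalType) (to : left_action gT X) (q n : nat) :
  prime #|gT| -> (q <= #|gT|)%N -> ind R e q to = Some 0%N ->
  secat (orbit_proj to) = Some n -> (n <= q.-1)%N.
Proof.
move=> pr qp /least_SomeP[[f eqf] _].
have [S [sliceS covS]] := slices_of_equivariant_map pr qp eqf.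
exact: slices_secat.
Qed.

Theorem corollary4p2 (R : realType) (p q : nat)
    (p_prime : prime p) (q_ge2 : (2 <= q)%N) (q_le_p : (q <= p)%N)
    (gT : finGroupType) (gT_cyclic : cyclic [set: gT]) (gT_order : #|gT| = p)
    (e : enumeration gT)
    (X : topologicalType) (to : left_action gT X)
    (X_free : free_Gspace to) (X_paracompact : paracompact X)
    (ind_finite : ind R e q to <> None) :
  (secat (orbit_proj to) = Some 2%N ->
     ((3 <= q)%N -> ind R e q to = Some 0%N) /\
     (q = 2%N -> ind R e q to = Some 1%N))
  /\
  (secat (orbit_proj to) = Some 3%N ->
     [/\ (4 <= q)%N -> ind R e q to = Some 0%N,
         q = 3%N -> ind R e q to = Some 1%N
       & q = 2%N -> ind R e q to = Some 1%N \/ ind R e q to = Some 2%N]).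
Proof.
have upper n k : secat (orbit_proj to) = Some n -> (n <= k.+1 * q.-1)%N ->
    exists2 d, ind R e q to = Some d & (d <= k)%N.
  by apply: ind_le_secat => //; apply: ltnW.
have lower n : secat (orbit_proj to) = Some n -> ind R e q to = Some 0%N ->
    (n <= q.-1)%N.
  by move=> secn ind0; apply: secat_le_ind0 ind0 secn; rewrite gT_order.
split=> secX.
  split=> [q_ge|qE].
    have [|d -> ] := upper _ 0%N secX; first by rewrite mul1n ltn_predRL.
    by rewrite leqn0 => /eqP ->.
  (* Here 2 <= 2 · 1 bounds the index by 1, and index 0 would force 2 <= 1. *)
  subst q; have [//|[|[|d]] indE // _] := upper _ 1%N secX.
  by have := lower _ secX indE.
split=> [q_ge|qE|qE].
- have [|d -> ] := upper _ 0%N secX; first by rewrite mul1n ltn_predRL.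
  by rewrite leqn0 => /eqP ->.
(* Here 3 <= 2 · 2 bounds the index by 1, and index 0 would force 3 <= 2. *)
- subst q; have [//|[|[|d]] indE // _] := upper _ 1%N secX.
  by have := lower _ secX indE.
(* With [q.-1] equal to 1 the upper bound needs [k] = 2, while the lower bound excludes only 0. *)
- subst q; have [//|[|[|[|d]]] indE // _] := upper _ 2%N secX.
  + by have := lower _ secX indE.
  + by left.
  + by right.
Qed.
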